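(* Let $d\geqslant 2$ be an integer. The ideal of relations of $\mathcal{C}$ is generated in degrees $\leqslant d$ if the following two conditions are satisfied: (i) The composition map $\operatorname{Hom}_{\mathcal{C}}(l,n)\times\operatorname{Hom}_{\mathcal{C}}(m,l)\to\operatorname{Hom}_{\mathcal{C}}(m,n)$ is surjective whenever $m<l<n$. (ii) For every $\alpha_1,\alpha_2\in\operatorname{Hom}_{\mathcal{C}}(m+1,n)$ and $\beta_1,\beta_2\in\operatorname{Hom}_{\mathcal{C}}(m,m+1)$ satisfying $\alpha_1\beta_1=\alpha_2\beta_2$ and $n>m+d$, there exist $\gamma\in\operatorname{Hom}_{\mathcal{C}}(m+d,n)$ and $\delta_1,\delta_2\in\operatorname{Hom}_{\mathcal{C}}(m+1,m+d)$ such that $$\gamma\delta_1=\alpha_1,\qquad \gamma\delta_2=\alpha_2,\qquad \delta_1\beta_1=\delta_2\beta_2 .$$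
   Context: $R$ is a commutative ring and $\mathbb{Z}_+$ is the set of non-negative integers. $\mathcal{C}$ is a small category with $\operatorname{Ob}(\mathcal{C})=\mathbb{Z}_+$ and $\operatorname{Hom}_{\mathcal{C}}(m,n)=\emptyset$ whenever $m>n$. Let $\mathcal{A}=\mathcal{A}_{\mathcal{C}}$ be the $R$-linear category with $\operatorname{Ob}(\mathcal{A})=\mathbb{Z}_+$ and $\operatorname{Hom}_{\mathcal{A}}(m,n)$ the free $R$-module with basis $\operatorname{Hom}_{\mathcal{C}}(m,n)$, with composition extended bilinearly. Let $A_{\mathcal{C}}=\bigoplus_{m,n\in\mathbb{Z}_+}\operatorname{Hom}_{\mathcal{A}}(m,n)$ be its category algebra. Ideal of relations. Set $\widetilde{\mathcal{A}}(m,m):=\operatorname{End}_{\mathcal{A}}(m)$ and, for $n\geqslant m+1$, $$\widetilde{\mathcal{A}}(m,n):=\operatorname{Hom}_{\mathcal{A}}(n-1,n)\otimes_{\operatorname{End}_{\mathcal{A}}(n-1)}\cdots\otimes_{\operatorname{End}_{\mathcal{A}}(m+1)}\operatorname{Hom}_{\mathcal{A}}(m,m+1).$$ For $n\geqslant m$ let $\widetilde{I}(m,n)$ be the kernel of the natural map $\widetilde{\mathcal{A}}(m,n)\to\operatorname{Hom}_{\mathcal{A}}(m,n)$ given by composition. For an integer $d\geqslant 1$, the ideal of relations of $A_{\mathcal{C}}$ is generated in degrees $\leqslant d$ if, whenever $n\geqslant m+2$, the map $\widetilde{\mathcal{A}}(m,n)\to\operatorname{Hom}_{\mathcal{A}}(m,n)$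 is surjective, and, whenever $n\geqslant m+d$, $$\widetilde{I}(m,n)=\sum_{r=m}^{n-d}\widetilde{\mathcal{A}}(r+d,n)\otimes_{\operatorname{End}_{\mathcal{A}}(r+d)}\widetilde{I}(r,r+d)\otimes_{\operatorname{End}_{\mathcal{A}}(r)}\widetilde{\mathcal{A}}(m,r),$$ where each summand denotes its image in $\widetilde{\mathcal{A}}(m,n)$ under concatenation of tensors. The ideal of relations of $\mathcal{C}$ is said to be generated in degrees $\leqslant d$ if the ideal of relations of $A_{\mathcal{C}}$ is generated in degrees $\leqslant d$. *)

(* Defs.v *)
From HB Require Import structures.
From mathcomp Require Import all_boot all_algebra ring_quotient finmap.
From mathcomp Require Import boolp classical_sets functions cardinality fsbigop.

Set Implicit Arguments.
Unset Strict Implicit.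
Unset Printing Implicit Defensive.

Import GRing.Theory.
Local Open Scope classical_set_scope.
Local Open Scope ring_scope.

Section LinearSpan.
Context {R : pzRingType} {V : lmodType R}.
Implicit Types (S : set V) (u v : V).

Definition lspan S : set V :=
  [set v | exists2 s : seq (R * V),
     (forall p, p \in s -> S p.2) & v = \sum_(p <- s) p.1 *: p.2].

Lemma lspan0 S : lspan S 0.
Proof. by exists [::] => //; rewrite big_nil. Qed.

Lemma lspanZD S a u v : lspan S u -> lspan S v -> lspan S (a *: u + v).
Proof.
move=> [s Ss ->] [t St ->]; exists ([seq (a * p.1, p.2) | p <- s] ++ t).
  move=> p; rewrite mem_cat => /orP[/mapP[q qs ->]|]; last exact: St.
  exact: (Ss q).
rewrite big_cat big_map scaler_sumr /=; congr (_ + _).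
by apply: eq_bigr => p _; rewrite scalerA.
Qed.

Lemma sub_lspan S u : S u -> lspan S u.
Proof.
move=> Su; exists [:: (1, u)] => [p|]; last by rewrite big_seq1 scale1r.
by rewrite inE => /eqP ->.
Qed.

Lemma lspan_min S (T : set V) : S `<=` T -> T 0 ->
  (forall a u v, T u -> T v -> T (a *: u + v)) -> lspan S `<=` T.
Proof.
move=> ST T0 TZD u [s Ss ->]; elim: s Ss => [|p s IH] Ss.
  by rewrite big_nil.
rewrite big_cons; apply: TZD; first by apply: ST; apply: Ss; exact: mem_head.
by apply: IH => q qs; apply: Ss; rewrite inE qs orbT.
Qed.

Definition in_lspan S : {pred V} := fun v => `[< lspan S v >].

Lemma in_lspanE S v : (v \in in_lspan S) = `[< lspan S v >].
Proof. by []. Qed.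

Lemma in_lspan_submod_closed S : submod_closed (in_lspan S).
Proof.
split=> [|a u v /asboolP Su /asboolP Sv]; first by apply/asboolP/lspan0.
by apply/asboolP/lspanZD.
Qed.
HB.instance Definition _ S :=
  GRing.isSubmodClosed.Build R V (in_lspan S) (in_lspan_submod_closed S).

End LinearSpan.

Section QuotientModule.
Context {R : pzRingType} {V : lmodType R}.
Variable S : set V.
Local Open Scope quotient_scope.

Definition qmod := Quotient.quot (in_lspan S).
HB.instance Definition _ := GRing.Zmodule.on qmod.

Definition qpi (v : V) : qmod := \pi_(Quotient.quot (in_lspan S)) v.
Definition qrepr (x : qmod) : V := repr (x : Quotient.quot (in_lspan S)).

Lemma qreprK x : qpi (qrepr x) = x. Proof. exact: reprK. Qed.

Lemma qpiP u v : qpi u = qpi v <-> lspan S (u - v).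
Proof.
split=> [/eqP|H].
  by rewrite -Quotient.idealrBE => /asboolP.
by apply/eqP; rewrite -Quotient.idealrBE; apply/asboolP.
Qed.

Lemma qpiD u v : qpi (u + v) = qpi u + qpi v.
Proof. exact: (raddfD (\pi_(Quotient.quot (in_lspan S)))). Qed.

Definition qscale (a : R) (x : qmod) : qmod := qpi (a *: qrepr x).

Lemma qpiZ a v : qpi (a *: v) = qscale a (qpi v).
Proof.
apply/qpiP; rewrite -scalerBr; have /qpiP H : qpi v = qpi (qrepr (qpi v)).
  by rewrite qreprK.
by rewrite -[a *: _]addr0; apply: lspanZD => //; exact: lspan0.
Qed.

Fact qscaleA a b x : qscale a (qscale b x) = qscale (a * b) x.
Proof. by rewrite -[x]qreprK -!qpiZ scalerA. Qed.
Fact qscale1 x : qscale 1 x = x.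
Proof. by rewrite -[x]qreprK -!qpiZ scale1r. Qed.
Fact qscaleDr : right_distributive qscale +%R.
Proof.
by move=> a x y; rewrite -[x]qreprK -[y]qreprK -qpiD -!qpiZ -qpiD scalerDr.
Qed.
Fact qscaleDl x : {morph qscale^~ x : a b / a + b}.
Proof. by move=> a b /=; rewrite -[x]qreprK -!qpiZ -qpiD scalerDl. Qed.
HB.instance Definition _ := GRing.Zmodule_isLmodule.Build R qmod
  qscaleA qscale1 qscaleDr qscaleDl.

Lemma qpi_linear : linear qpi.
Proof. by move=> a u v; rewrite qpiD qpiZ. Qed.
HB.instance Definition _ := GRing.isLinear.Build R V qmod *:%R qpi qpi_linear.

End QuotientModule.

Section FreeModule.
Context {R : pzRingType} {K : choiceType}.

Definition fin_support : {pred K -> R^o} :=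
  fun f => `[< finite_set [set k | f k != 0] >].

Lemma fin_support_submod_closed : submod_closed fin_support.
Proof.
split=> [|a f g /asboolP ff /asboolP fg]; apply/asboolP.
  by rewrite (_ : [set _ | _] = set0) // -subset0 => k /=; rewrite eqxx.
apply: (@sub_finite_set _ _ ([set k | f k != 0] `|` [set k | g k != 0])).
  move=> k /= H; apply/orP; apply: contraNT H.
  rewrite negb_or !negbK => /andP[/eqP fk /eqP gk].
  have -> : (a *: f + g) k = a *: f k + g k by [].
  by rewrite fk gk scaler0 addr0.
by rewrite finite_setU.
Qed.
HB.instance Definition _ := GRing.isSubmodClosed.Build R (K -> R^o)
  fin_support fin_support_submod_closed.

End FreeModule.

Record freemod (R : pzRingType) (K : choiceType) := FreeMod {
  coef : K -> R^o;
  coef_fin : coef \in fin_support }.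

Section FreeModuleTheory.
Context {R : pzRingType} {K : choiceType}.
HB.instance Definition _ := [isSub for @coef R K].
HB.instance Definition _ := [Choice of freemod R K by <:].
HB.instance Definition _ := [SubChoice_isSubLmodule of freemod R K by <:].

Definition dirac_fun (k : K) : K -> R^o := fun l => (l == k)%:R.

Fact dirac_subproof k : dirac_fun k \in fin_support.
Proof.
apply/asboolP/(@sub_finite_set _ _ [set k]) => [l /=|]; last exact: finite_set1.
by rewrite /dirac_fun; case: (l =P k) => //; rewrite eqxx.
Qed.

Definition basis_elt k : freemod R K := FreeMod (dirac_subproof k).

Definition linext (V : lmodType R) (phi : K -> V) (a : freemod R K) : V :=
  \sum_(k \in [set: K]) (coef a k : R) *: phi k.

Lemma coefZD c a b k : coef (c *: a + b) k = c * coef a k + coef b k :> R.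
Proof. by []. Qed.

Lemma freemodP (a b : freemod R K) : coef a =1 coef b -> a = b.
Proof. by move=> ab; apply/val_inj/funext. Qed.

Definition fsupp (a : freemod R K) : {fset K} :=
  fset_set [set k | coef a k != 0].

Lemma mem_fsupp a k : (k \in fsupp a) = (coef a k != 0).
Proof.
have /asboolP fina := coef_fin a.
by rewrite in_fset_set //; apply/idP/idP; rewrite inE.
Qed.

Lemma linextE (V : lmodType R) (phi : K -> V) a (D : {fset K}) :
  (forall k, coef a k != 0 -> k \in D) ->
  linext phi a = \sum_(k <- D) (coef a k : R) *: phi k.
Proof.
move=> aD; apply: fsbigTE => k; apply: contraNeq => H; apply: aD.
by apply: contraNneq H => ->; rewrite scale0r.
Qed.

Lemma linext_linear (V : lmodType R) (phi : K -> V) : linear (linext phi).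
Proof.
move=> c a b; pose D := (fsupp a `|` fsupp b)%fset.
have aD k : coef a k != 0 -> k \in D by rewrite in_fsetU !mem_fsupp => ->.
have bD k : coef b k != 0 -> k \in D.
  by rewrite in_fsetU !mem_fsupp => ->; rewrite orbT.
have abD k : coef (c *: a + b) k != 0 -> k \in D.
  rewrite in_fsetU !mem_fsupp; apply: contraNT.
  rewrite negb_or !negbK => /andP[/eqP ak /eqP bk].
  by apply/eqP; rewrite coefZD ak bk mulr0 addr0.
rewrite (linextE phi abD) (linextE phi aD) (linextE phi bD).
rewrite scaler_sumr -big_split; apply: eq_bigr => k _ /=.
by rewrite scalerA -scalerDl.
Qed.
HB.instance Definition _ (V : lmodType R) (phi : K -> V) :=
  GRing.isLinear.Build R (freemod R K) V *:%R (linext phi) (linext_linear phi).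

Lemma linext_basis (V : lmodType R) (phi : K -> V) k :
  linext phi (basis_elt k) = phi k.
Proof.
rewrite (@linextE _ _ _ [fset k]%fset).
  by rewrite big_seq_fset1 /= /dirac_fun eqxx scale1r.
move=> l /=; rewrite /dirac_fun inE; case: (l =P k) => //.
by rewrite eqxx.
Qed.

Lemma freemod_expand a :
  a = \sum_(k <- fsupp a) (coef a k : R) *: basis_elt k.
Proof.
apply: freemodP => k.
have coefD (s : seq K) : coef (\sum_(l <- s) (coef a l : R) *: basis_elt l) k =
    \sum_(l <- s) (coef a l * (k == l)%:R).
  elim: s => [|l s IH]; first by rewrite !big_nil.
  by rewrite !big_cons coefZD IH.
rewrite coefD; have [ka|ka] := boolP (k \in fsupp a).
  rewrite (big_fsetD1 k) //= eqxx mulr1 big_seq big1 ?addr0 // => l.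
  by rewrite in_fsetD1 eq_sym; case: eqP => //=; rewrite mulr0.
rewrite big_seq big1 => [|l la]; first by move: ka; rewrite mem_fsupp negbK => /eqP.
by case: (k =P l) => [kl|]; [rewrite kl la in ka | rewrite mulr0].
Qed.

End FreeModuleTheory.

Section BalancedTensor.
Context {R : comPzRingType} {M N : lmodType R} {S : Type}.
Variables (ract : M -> S -> M) (lact : S -> N -> N).

Definition pair_elt (m : M) (n : N) : freemod R (M * N)%type :=
  basis_elt (m, n).

(* For an R-algebra S, a right S-module M and a left S-module N (with central
   action of R), M (x)_S N is the free R-module on M * N modulo R-bilinearity
   and the balancing relation m s (x) n = m (x) s n. *)
Inductive tensor_rel : set (freemod R (M * N)%type) :=
| TensorDl m m' n :
    tensor_rel (pair_elt (m + m') n - (pair_elt m n + pair_elt m' n))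
| TensorDr m n n' :
    tensor_rel (pair_elt m (n + n') - (pair_elt m n + pair_elt m n'))
| TensorZl r m n : tensor_rel (pair_elt (r *: m) n - r *: pair_elt m n)
| TensorZr r m n : tensor_rel (pair_elt m (r *: n) - r *: pair_elt m n)
| TensorB m s n : tensor_rel (pair_elt (ract m s) n - pair_elt m (lact s n)).

Definition tensor := qmod tensor_rel.
HB.instance Definition _ := GRing.Lmodule.on tensor.

Definition tens (m : M) (n : N) : tensor := qpi tensor_rel (pair_elt m n).

(* The R-linear map m (x) n |-> phi m n: it is defined on a representative,
   and only meaningful for phi bilinear and balanced, see tens_lift_linear and
   tens_liftE. *)
Definition tens_lift (P : lmodType R) (phi : M -> N -> P) (t : tensor) : P :=
  linext (fun mn => phi mn.1 mn.2) (qrepr t).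

Definition balanced (P : lmodType R) (phi : M -> N -> P) : Prop :=
  [/\ forall n, linear (phi^~ n), forall m, linear (phi m)
    & forall m s n, phi (ract m s) n = phi m (lact s n)].

Section Lift.
Context {P : lmodType R} {phi : M -> N -> P}.
Hypothesis bphi : balanced phi.

Lemma tens_lift_pi a :
  tens_lift phi (qpi tensor_rel a) = linext (fun mn => phi mn.1 mn.2) a.
Proof.
have [bl br bb] := bphi; rewrite /tens_lift.
pose f0 := linext (fun mn : M * N => phi mn.1 mn.2).
have [f f0E] : exists f : {linear freemod R (M * N)%type -> P}, f0 =1 f.
  by exists f0.
rewrite -/f0 !f0E.
have fE m n : f (pair_elt m n) = phi m n.
  by rewrite -f0E; exact: linext_basis.
have fZ r t : f (r *: t) = r *: f t by exact: linearZ_LR.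
have fker : lspan tensor_rel `<=` [set t | f t = 0].
  apply: lspan_min => /= [t||r u v Hu Hv].
  - have [phi0 phi0'] : (forall n, phi 0 n = 0) /\ (forall m, phi m 0 = 0).
      split=> k; [have := bl k (-1) 0 0 | have := br k (-1) 0 0];
      by rewrite /= !scaleN1r !oppr0 !addr0 !addNr.
    case=> [m m' n|m n n'|r m n|r m n|m s n];
      rewrite /= (raddfB f) ?(raddfD f) /= ?fZ !fE.
    + by have /= := bl n 1 m m'; rewrite !scale1r => ->; rewrite subrr.
    + by have /= := br m 1 n n'; rewrite !scale1r => ->; rewrite subrr.
    + by have /= := bl n r m 0; rewrite !addr0 phi0 addr0 => ->; rewrite subrr.
    + by have /= := br m r n 0; rewrite !addr0 phi0' addr0 => ->; rewrite subrr.
    + by rewrite bb subrr.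
  - exact: linear0.
  - by rewrite linearP Hu Hv scaler0 addr0.
apply/eqP; rewrite -subr_eq0; apply/eqP.
rewrite -[LHS](linearB f); apply: fker; apply/qpiP; exact: qreprK.
Qed.

Lemma tens_lift_linear : linear (tens_lift phi).
Proof.
move=> r x y; rewrite -[x]qreprK -[y]qreprK -linearP !tens_lift_pi.
exact: linearP.
Qed.

Lemma tens_liftE m n : tens_lift phi (tens m n) = phi m n.
Proof. by rewrite tens_lift_pi linext_basis. Qed.

End Lift.

Lemma tens_balanced : balanced tens.
Proof.
have rel t : tensor_rel t -> qpi tensor_rel t = 0.
  by move=> Ht; rewrite -(linear0 (qpi tensor_rel)); apply/qpiP;
     rewrite subr0; exact: sub_lspan.
have eq0 u v : tensor_rel (u - v) -> qpi tensor_rel u = qpi tensor_rel v.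
  by move=> /rel; rewrite linearB => /eqP; rewrite subr_eq0 => /eqP.
split=> [n r m m'|m r n n'|m s n].
- transitivity (tens (r *: m) n + tens m' n).
    by rewrite /tens -linearD; apply: eq0; exact: TensorDl.
  by congr (_ + _); rewrite /tens -linearZ; apply: eq0; exact: TensorZl.
- transitivity (tens m (r *: n) + tens m n').
    by rewrite /tens -linearD; apply: eq0; exact: TensorDr.
  by congr (_ + _); rewrite /tens -linearZ; apply: eq0; exact: TensorZr.
- by apply: eq0; exact: TensorB.
Qed.

Lemma tens_ind (P : tensor -> Prop) :
  P 0 -> (forall r x y, P x -> P y -> P (r *: x + y)) ->
  (forall m n, P (tens m n)) -> forall x, P x.
Proof.
move=> P0 PZD Pt x; rewrite -[x]qreprK [qrepr x]freemod_expand.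
elim: (X in \sum_(k <- X) _) => [|[m n] s IH]; first by rewrite big_nil linear0.
rewrite big_cons linearP; apply: PZD; [exact: Pt | exact: IH].
Qed.

End BalancedTensor.
Arguments tensor_rel {R M N S}.
Arguments tensor {R M N S}.
Arguments tens {R M N S}.
Arguments tens_lift {R M N S} _ _ {P}.
Arguments balanced {R M N S} _ _ {P}.

Record natcat := NatCat {
  mor : nat -> nat -> Type;
  mor_id : forall n, mor n n;
  mor_comp : forall m l n, mor l n -> mor m l -> mor m n;
  mor_compA : forall k l m n (h : mor m n) (g : mor l m) (f : mor k l),
    mor_comp h (mor_comp g f) = mor_comp (mor_comp h g) f;
  mor_comp1f : forall m n (f : mor m n), mor_comp (mor_id n) f = f;
  mor_compf1 : forall m n (f : mor m n), mor_comp f (mor_id m) = f;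
  mor_empty : forall m n, (n < m)%N -> mor m n -> False }.

Section Linearization.
Variables (R : comPzRingType) (C : natcat).

Definition lhom (m n : nat) : lmodType R := freemod R {classic mor C m n}.

Definition of_mor m n (f : mor C m n) : lhom m n :=
  basis_elt (f : {classic mor C m n}).

Definition lcmp m l n (g : lhom l n) (f : lhom m l) : lhom m n :=
  linext (fun g0 : {classic mor C l n} =>
    linext (fun f0 : {classic mor C m l} => of_mor (@mor_comp C m l n g0 f0)) f) g.

(* The data carried along the recursive construction of \tilde A(m,n): the
   R-module, its left End(n)-action and the composition map to Hom(m,n). *)
Record tdata (m n : nat) := TData {
  tcar :> lmodType R;
  tact : lhom n n -> tcar -> tcar;
  tmu : tcar -> lhom m n }.

Definition hom_tdata m n : tdata m n :=
  @TData m n (lhom m n) (@lcmp m n n) id.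

(* \tilde A(m,n+1) = Hom(n,n+1) (x)_{End(n)} \tilde A(m,n) *)
Definition tens_tdata m n (X : tdata m n) : tdata m n.+1 :=
  @TData m n.+1 (tensor (@lcmp n n n.+1) (@tact m n X))
    (fun s => tens_lift _ _ (fun f x => tens _ _ (lcmp s f) x))
    (tens_lift _ _ (fun f x => lcmp f (tmu x))).

(* For m <= n this is \tilde A(m,n), with \tilde A(m,m) = End(m) and
   \tilde A(m,m+1) = Hom(m,m+1); for m > n it is the zero module Hom(m,n). *)
Fixpoint tA (m n : nat) : tdata m n :=
  match n with
  | 0 => hom_tdata m 0
  | n'.+1 => if (m < n')%N then tens_tdata (tA m n') else hom_tdata m n'.+1
  end.

Definition tcons m n : lhom n n.+1 -> tA m n -> tA m n.+1 :=
  match (m < n)%N as b return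
    lhom n n.+1 -> tA m n ->
    (if b then tens_tdata (tA m n) else hom_tdata m n.+1)
  with
  | true => fun f x => tens _ _ f x
  | false => fun f x => lcmp f (tmu x)
  end.

Definition tuncons m n (P : lmodType R)
    (phi : lhom n n.+1 -> tA m n -> P) (psi : lhom m n.+1 -> P) :
    tA m n.+1 -> P :=
  match (m < n)%N as b return
    (if b then tens_tdata (tA m n) else hom_tdata m n.+1) -> P
  with
  | true => tens_lift _ _ phi
  | false => psi
  end.

(* The concatenation (f_j (x) .. (x) f_1) (x) y |-> f_j (x) .. (x) f_1 (x) y *)
Fixpoint tcat_off m r j (y : tA m r) : tA r (j + r) -> tA m (j + r) :=
  match j return tA r (j + r) -> tA m (j + r) with
  | 0 => fun x => tact (tmu x) y
  | j'.+1 => @tuncons r (j' + r) _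
      (fun f x => tcons f (@tcat_off m r j' y x))
      (match j' return lhom r (j'.+1 + r) -> tA m (j'.+1 + r) with
       | 0 => fun f => tcons f y
       | _ => fun=> 0
       end)
  end.

Definition tcat m r n (x : tA r n) (y : tA m r) : tA m n :=
  match @idP (r <= n)%N with
  | ReflectT le_rn =>
      ecast k (tA m k) (subnK le_rn)
        (tcat_off y (ecast k (tA r k) (esym (subnK le_rn)) x))
  | ReflectF _ => 0
  end.

Definition tI m n : set (tA m n) := [set x | tmu x = 0].

(* The image of \tilde A(r+d,n) (x) \tilde I(r,r+d) (x) \tilde A(m,r) in
   \tilde A(m,n). *)
Definition tI_summand d m n r : set (tA m n) :=
  lspan [set t | exists (x : tA (r + d) n) (y : tA r (r + d)) (z : tA m r),
                   tI y /\ t = tcat x (tcat y z)].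

Definition tI_gen d m n : set (tA m n) :=
  [set t | exists2 u : nat -> tA m n,
     (forall r, (m <= r <= n - d)%N -> tI_summand d r (u r)) &
     t = \sum_(m <= r < (n - d).+1) u r].

Definition relations_gen_le (d : nat) : Prop :=
  (forall m n, (m + 2 <= n)%N ->
     forall f : lhom m n, exists x : tA m n, tmu x = f)
  /\ (forall m n, (m + d <= n)%N -> @tI m n = @tI_gen d m n).

End Linearization.

(* Main.v *)
(* Only the inclusion of the relations (the kernel of composition) in the ideal
   generated by the relations in degree d needs work; it goes by induction on
   n - m.  By (i) the kernel in \tilde A(m,n) is spanned by the differences
   u1 (x) b1 - u2 (x) b2 with bi in Hom(m,m+1) and ui over ai in Hom(m+1,n) such
   that a1 b1 = a2 b2.  If n > m + d, write ai = c ei with e1 b1 = e2 b2 by (ii)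
   and lift c and ei to x and yi: ui - x (x) yi is a relation in
   \tilde A(m+1,n), covered by induction, while x (x) (y1 (x) b1 - y2 (x) b2)
   comes from a relation in \tilde A(m,m+d). *)
Require Import Defs.
From mathcomp Require Import all_boot all_algebra.
From mathcomp Require Import boolp classical_sets.

Set Implicit Arguments.
Unset Strict Implicit.
Unset Printing Implicit Defensive.

Import GRing.Theory.

(** * Linear maps and predicates closed under linear combinations *)

Section LinearPredicates.
Local Open Scope ring_scope.
Context {R : pzRingType} {U V W : lmodType R}.

Lemma linear_fun0 (f : U -> V) : linear f -> f 0 = 0.
Proof.
by move=> lf; have := lf (-1) 0 0; rewrite /= !scaleN1r !oppr0 !addr0 addNr.
Qed.

Lemma linear_funB (f : U -> V) x y : linear f -> f (x - y) = f x - f y.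
Proof. by move=> lf; rewrite addrC -scaleN1r lf scaleN1r addrC. Qed.

Lemma linear_fun_comp (g : V -> W) (f : U -> V) :
  linear g -> linear f -> linear (fun x => g (f x)).
Proof. by move=> lg lf a x y /=; rewrite lf lg. Qed.

(** A submodule as a bare predicate. The induction principles below take it as a premise, so that an
    identity between linear maps is checked on generators only. *)
Definition linear_closed_set (P : U -> Prop) :=
  P 0 /\ forall a x y, P x -> P y -> P (a *: x + y).

Lemma linear_closed_eq (f g : U -> V) :
  linear f -> linear g -> linear_closed_set (fun x => f x = g x).
Proof.
move=> lf lg; split=> [|a x y fx fy]; first by rewrite !linear_fun0.
by rewrite lf lg fx fy.
Qed.

Lemma linear_closedB (P : U -> Prop) x y :
  linear_closed_set P -> P x -> P y -> P (x - y).
Proof. by case=> _ PZD Px Py; rewrite addrC -scaleN1r; apply: PZD. Qed.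

End LinearPredicates.

Lemma linear_closed_preim (R : pzRingType) (U V : lmodType R) (P : V -> Prop)
    (f : U -> V) :
  linear_closed_set P -> linear f -> linear_closed_set (fun x => P (f x)).
Proof.
move=> [P0 PZD] lf; split=> [|a x y fx fy]; first by rewrite linear_fun0.
by rewrite lf; apply: PZD.
Qed.

Lemma freemod_ind (R : pzRingType) (K : choiceType) (P : freemod R K -> Prop) :
  linear_closed_set P -> (forall k, P (basis_elt k)) -> forall a, P a.
Proof.
move=> [P0 PZD] Pb a; rewrite [a]freemod_expand.
elim: (X in bigop _ X _) => [|k s IH]; first by rewrite big_nil.
by rewrite big_cons; apply: PZD.
Qed.

Lemma linear_linext (R : pzRingType) (K : choiceType) (V : lmodType R)
  (phi : K -> V) : linear (linext phi).
Proof. exact: linext_linear. Qed.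

(** * Bilinearity, associativity and units of composition in the linearized category *)

Section Composition.
Local Open Scope ring_scope.
Variables (R : comPzRingType) (C : natcat).
Notation lhom := (lhom R C).
Notation of_mor := (@of_mor R C _ _).
Notation lcmp := (@lcmp R C _ _ _).

Lemma lhom_ind m n (P : lhom m n -> Prop) :
  linear_closed_set P -> (forall h, P (of_mor h)) -> forall f, P f.
Proof. exact: freemod_ind. Qed.

Lemma lcmp_basis m l n (g : mor C l n) (f : mor C m l) :
  lcmp (of_mor g) (of_mor f) = of_mor (mor_comp g f).
Proof. by rewrite /Defs.lcmp !linext_basis. Qed.

Lemma lcmp_linearl m l n (f : lhom m l) : linear (fun g : lhom l n => lcmp g f).
Proof. exact: linext_linear. Qed.

(** [lcmp] is a linear extension in g by construction. For a basis morphism g it is also one in f,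
    and the passage to general g exchanges two scalars, by commutativity of R. *)
Lemma lcmp_linearr m l n (g : lhom l n) : linear (fun f : lhom m l => lcmp g f).
Proof.
move=> a x y /=; elim/lhom_ind: g => [|g].
  apply: linear_closed_eq; first exact: lcmp_linearl.
  move=> b g g' /=; rewrite !lcmp_linearl !scalerDr !scalerA (mulrC a b).
  by rewrite -!addrA; congr (_ + _); rewrite addrCA.
by rewrite /Defs.lcmp !linext_basis; exact: linext_linear.
Qed.

Lemma lcmpA k l m n (h : lhom m n) (g : lhom l m) (f : lhom k l) :
  lcmp h (lcmp g f) = lcmp (lcmp h g) f.
Proof.
elim/lhom_ind: h => [|h].
  apply: linear_closed_eq; first exact: lcmp_linearl.
  by apply: (linear_fun_comp (lcmp_linearl f)); exact: lcmp_linearl.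
elim/lhom_ind: g => [|g].
  apply: linear_closed_eq.
    by apply: (linear_fun_comp (lcmp_linearr _)); exact: lcmp_linearl.
  by apply: (linear_fun_comp (lcmp_linearl f)); exact: lcmp_linearr.
elim/lhom_ind: f => [|f].
  apply: linear_closed_eq; last exact: lcmp_linearr.
  by apply: (linear_fun_comp (lcmp_linearr _)); exact: lcmp_linearr.
by rewrite !lcmp_basis mor_compA.
Qed.

Definition lid n : lhom n n := of_mor (mor_id C n).

Lemma lcmp1f m n (f : lhom m n) : lcmp (lid n) f = f.
Proof.
elim/lhom_ind: f => [|f]; last by rewrite lcmp_basis mor_comp1f.
by apply: linear_closed_eq => //; exact: lcmp_linearr.
Qed.

Lemma lcmpf1 m n (f : lhom m n) : lcmp f (lid m) = f.
Proof.
elim/lhom_ind: f => [|f]; last by rewrite lcmp_basis mor_compf1.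
by apply: linear_closed_eq => //; exact: lcmp_linearl.
Qed.

End Composition.

(** * One step of the iterated tensor product *)

Section TensorData.
Local Open Scope ring_scope.
Variables (R : comPzRingType) (C : natcat).
Notation lhom := (lhom R C).
Notation lcmp := (@lcmp R C _ _ _).

(** Invariants of the recursive construction: [tmu_linear] and [tmu_tact] make composition balanced,
    so that it descends to the next tensor product; the laws of [tact] serve concatenation. *)
Record tdata_laws m n (X : tdata R C m n) : Prop := TDataLaws {
  tmu_linear : linear (@tmu R C m n X);
  tact_linearr : forall s, linear (@tact R C m n X s);
  tact_linearl : forall x, linear (fun s => @tact R C m n X s x);
  tmu_tact : forall s x, tmu (@tact R C m n X s x) = lcmp s (tmu x);
  tactA : forall s t x,
    @tact R C m n X (lcmp s t) x = tact s (tact t x);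
  tact1 : forall x, @tact R C m n X (lid R C n) x = x }.

Lemma hom_tdata_laws m n : tdata_laws (hom_tdata R C m n).
Proof.
split=> //=; [exact: lcmp_linearr | exact: lcmp_linearl | | exact: lcmp1f].
by move=> s t x; rewrite lcmpA.
Qed.

Section Tensor.
Variables (m n : nat) (X : tdata R C m n).
Hypothesis XP : tdata_laws X.
Notation ract := (@Defs.lcmp R C n n n.+1).
Notation lact := (@tact R C m n X).
Notation T := (tensor ract lact).

Lemma tens_linearl x : linear (fun f => tens ract lact f x).
Proof. by have [l _ _] := tens_balanced ract lact; exact: l. Qed.

Lemma tens_linearr f : linear (tens ract lact f).
Proof. by have [_ r _] := tens_balanced ract lact; exact: r. Qed.

Lemma tens_act f s x : tens ract lact (lcmp f s) x = tens ract lact f (lact s x).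
Proof. by have [_ _ b] := tens_balanced ract lact; exact: b. Qed.

Lemma tensor_ind (P : T -> Prop) :
  linear_closed_set P -> (forall f x, P (tens ract lact f x)) -> forall x, P x.
Proof. by case=> P0 PZD Pt; apply: tens_ind. Qed.

Lemma tact_balanced s :
  balanced ract lact (fun f x => tens ract lact (lcmp s f) x).
Proof.
split=> [x|f|f t x].
- exact: (linear_fun_comp (tens_linearl x) (lcmp_linearr s)).
- exact: tens_linearr.
- by rewrite lcmpA tens_act.
Qed.

Lemma tmu_balanced : balanced ract lact (fun f x => lcmp f (tmu x)).
Proof.
split=> [x|f|f t x].
- exact: lcmp_linearl.
- exact: (linear_fun_comp (lcmp_linearr f) (tmu_linear XP)).
- by rewrite (tmu_tact XP) lcmpA.
Qed.

Lemma tens_tdata_act s f x :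
  @tact R C m n.+1 (tens_tdata X) s (tens ract lact f x) =
    tens ract lact (lcmp s f) x.
Proof. exact: (tens_liftE (tact_balanced s)). Qed.

Lemma tens_tdata_mu f x :
  @tmu R C m n.+1 (tens_tdata X) (tens ract lact f x) = lcmp f (tmu x).
Proof. exact: (tens_liftE tmu_balanced). Qed.

Lemma tens_tdata_laws : tdata_laws (tens_tdata X).
Proof.
have lmu : linear (@tmu R C m n.+1 (tens_tdata X)).
  exact: (tens_lift_linear tmu_balanced).
have lact1 s : linear (@tact R C m n.+1 (tens_tdata X) s).
  exact: (tens_lift_linear (tact_balanced s)).
split=> //.
- move=> x a s t; elim/tensor_ind: x => [|f x].
    apply: linear_closed_eq => // b x y; rewrite !lact1 !scalerDr !scalerA.
    by rewrite (mulrC a b) -!addrA; congr (_ + _); rewrite addrCA.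
  by rewrite !tens_tdata_act lcmp_linearl tens_linearl.
- move=> s x; elim/tensor_ind: x => [|f x].
    apply: linear_closed_eq; first exact: (linear_fun_comp lmu).
    exact: (linear_fun_comp (lcmp_linearr _)).
  by rewrite tens_tdata_act !tens_tdata_mu lcmpA.
- move=> s t x; elim/tensor_ind: x => [|f x].
    by apply: linear_closed_eq => //; exact: (linear_fun_comp (lact1 s)).
  by rewrite !tens_tdata_act lcmpA.
- move=> x; elim/tensor_ind: x => [|f x]; first exact: linear_closed_eq.
  by rewrite tens_tdata_act lcmp1f.
Qed.

End Tensor.
End TensorData.

(** * The modules [tA m n], concatenation and elementary tensors *)

Section IteratedTensor.
Local Open Scope ring_scope.
Variables (R : comPzRingType) (C : natcat).
Notation lhom := (lhom R C).
Notation lcmp := (@lcmp R C _ _ _).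
Notation tA := (tA R C).

Lemma tA_laws m n : tdata_laws (tA m n).
Proof.
elim: n => [|n IH] /=; first exact: hom_tdata_laws.
by case: ifP => _; [exact: tens_tdata_laws | exact: hom_tdata_laws].
Qed.

Lemma tA_mu_linear m n : linear (@tmu R C m n (tA m n)).
Proof. exact: tmu_linear (tA_laws m n). Qed.

Lemma tA_act_linear m n s : linear (@tact R C m n (tA m n) s).
Proof. exact: tact_linearr (tA_laws m n) s. Qed.

(** The recursion forms a tensor product only from n = m + 2 on. Quantifying over predicates on
    [tdata] avoids transport along an equality of modules. *)
Lemma tA_hom m n (P : tdata R C m n -> Prop) :
  (n <= m.+1)%N -> P (hom_tdata R C m n) -> P (tA m n).
Proof. by case: n P => [|n] P //= le_nm; rewrite ltnNge -ltnS le_nm. Qed.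

Lemma tA_mu_inj m n : (n <= m.+1)%N -> injective (@tmu R C m n (tA m n)).
Proof.
by move=> /(@tA_hom _ _ (fun X => injective (@tmu R C m n X))); apply=> x y.
Qed.

Lemma tA_mu_surj m n (f : lhom m n) : (n <= m.+1)%N -> exists x : tA m n, tmu x = f.
Proof.
by move=> /(@tA_hom _ _ (fun X => exists x : X, tmu x = f)); apply; exists f.
Qed.

Section Cons.
Variables m n : nat.

Lemma tcons_linearl (x : tA m n) : linear (fun f => tcons f x).
Proof.
rewrite /tcons /=; case: (m < n)%N => /=; first exact: tens_linearl.
exact: lcmp_linearl.
Qed.

Lemma tcons_linearr f : linear (fun x : tA m n => tcons f x).
Proof.
rewrite /tcons /=; case: (m < n)%N => /=; first exact: tens_linearr.
exact: (linear_fun_comp (lcmp_linearr f) (@tA_mu_linear m n)).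
Qed.

Lemma tcons_act f s (x : tA m n) : tcons (lcmp f s) x = tcons f (tact s x).
Proof.
rewrite /tcons /=; case: (m < n)%N => /=; first exact: tens_act.
by rewrite (tmu_tact (tA_laws m n)) lcmpA.
Qed.

Lemma tact_tcons s f (x : tA m n) : tact s (tcons f x) = tcons (lcmp s f) x.
Proof.
rewrite /tcons /=; case: (m < n)%N => /=; first exact: tens_tdata_act.
by rewrite lcmpA.
Qed.

Lemma tmu_tcons f (x : tA m n) : tmu (tcons f x) = lcmp f (tmu x).
Proof.
rewrite /tcons /=; case: (m < n)%N => //=.
exact: (tens_tdata_mu (tA_laws m n)).
Qed.

Lemma tA_ind (P : tA m n.+1 -> Prop) :
  (m <= n)%N -> linear_closed_set P ->
  (forall f (x : tA m n), P (tcons f x)) -> forall x, P x.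
Proof.
move=> le_mn PP Pc x; case: (ltngtP m n) le_mn => // [lt_mn|eq_mn] _.
  move: P PP Pc x; rewrite /tcons /= lt_mn => P PP Pc.
  exact: tensor_ind.
(* For n = m the module is Hom(m,m+1), and x is [tcons] of its own image and a lift of the
   identity. *)
have [y muy] : exists y : tA m n, tmu y = ecast k (lhom m k) eq_mn (lid R C m).
  by apply: tA_mu_surj; rewrite eq_mn.
have -> : x = tcons (ecast k (lhom k n.+1) eq_mn (tmu x)) y.
  apply: tA_mu_inj; first by rewrite eq_mn.
  rewrite tmu_tcons muy; case: n / eq_mn {P PP Pc y muy} x => x /=.
  by rewrite lcmpf1.
exact: Pc.
Qed.

Section Uncons.
Variables (P : lmodType R) (phi : lhom n n.+1 -> tA m n -> P).
Variable psi : lhom m n.+1 -> P.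
Hypothesis bphi : (m < n)%N -> balanced (@Defs.lcmp R C n n n.+1)
  (@tact R C m n (tA m n)) phi.

Lemma tuncons_tcons f x : (m < n)%N -> tuncons phi psi (tcons f x) = phi f x.
Proof.
move=> lt_mn; have := tens_liftE (bphi lt_mn) f x.
by rewrite /tuncons /tcons /=; case: (m < n)%N lt_mn.
Qed.

Lemma tuncons_hom f x :
  (m < n)%N = false -> tuncons phi psi (tcons f x) = psi (lcmp f (tmu x)).
Proof. by rewrite /tuncons /tcons /=; case: (m < n)%N. Qed.

Lemma tuncons_linear : linear psi -> linear (tuncons phi psi).
Proof.
move=> lpsi; rewrite /tuncons /=; case: (m < n)%N bphi => //= /(_ isT).
exact: tens_lift_linear.
Qed.

End Uncons.
End Cons.

(** * Laws of concatenation *)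

Section Concatenation.
Variables (m r : nat) (y : tA m r).

Lemma tcat_off0 (x : tA r r) : tcat_off (j := 0) y x = tact (tmu x) y.
Proof. by []. Qed.

(** Linearity over End(j + r). Compatibility with the left action at j makes the map defining
    [tcat_off] at j + 1 balanced, so both halves go through one induction. *)
Definition tcat_off_bilinear j :=
  linear (@tcat_off R C m r j y) /\
  forall s x, tcat_off (j := j) y (tact s x) = tact s (tcat_off y x).

Lemma tcat_off_balanced j : tcat_off_bilinear j ->
  balanced (@Defs.lcmp R C (j + r) (j + r) (j + r).+1)
    (@tact R C r (j + r) (tA r (j + r)))
    (fun f x => tcons f (@tcat_off R C m r j y x)).
Proof.
move=> [lin_j act_j]; split=> [x|f|f s x].
- exact: tcons_linearl.
- exact: (linear_fun_comp (tcons_linearr f) lin_j).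
- by rewrite act_j tcons_act.
Qed.

Lemma tcat_off_tcons_bilinear j : tcat_off_bilinear j -> forall f x,
  tcat_off (j := j.+1) y (tcons f x) = tcons f (tcat_off y x).
Proof.
case: j => [|j] bil_j f x.
  (* For j = 0 the argument is the single factor f (tmu x) in Hom(r,r+1); balancing moves tmu x
     across to y. *)
  rewrite tcat_off0 -tcons_act.
  by apply: (tuncons_hom _ (fun f => tcons f y)); rewrite ltnn.
apply: (@tuncons_tcons r (j.+1 + r)) => [_|]; first exact: tcat_off_balanced.
by rewrite addSn ltnS leq_addl.
Qed.

Lemma tcat_off_bilinearP j : tcat_off_bilinear j.
Proof.
elim: j => [|j bil_j].
  split=> [a u v|s x].
    by rewrite !tcat_off0 tA_mu_linear (tact_linearl (tA_laws m r)).
  by rewrite !tcat_off0 (tmu_tact (tA_laws r r)) (tactA (tA_laws m r)).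
have lin_Sj : linear (@tcat_off R C m r j.+1 y).
  apply: (@tuncons_linear r (j + r)) => [_|]; first exact: tcat_off_balanced.
  case: {bil_j} j => [|j]; first exact: tcons_linearl.
  (* Here the Hom branch of [tuncons] is the default 0: the tensor branch is the one selected, as r
     < j.+1 + r. *)
  by move=> a u v /=; rewrite scaler0 addr0.
split=> // s x; elim/tA_ind: x => [|| f x]; first exact: leq_addl.
  apply: linear_closed_eq.
    by apply: (linear_fun_comp lin_Sj); exact: tA_act_linear.
  by apply: linear_fun_comp; first exact: tA_act_linear.
by rewrite tact_tcons !tcat_off_tcons_bilinear // tact_tcons.
Qed.

Lemma tcatE j (x : tA r (j + r)) : tcat x y = tcat_off y x.
Proof.
rewrite /tcat; case: {-}_ / idP => [le_r|]; last by rewrite leq_addl.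
(* After [addnK] the equation reads j + r = j + r, and uniqueness of equality proofs on nat removes
   both transports. *)
move: (subnK le_r); rewrite addnK => e.
by rewrite (eq_irrelevance e erefl).
Qed.

Lemma tcat_diag (x : tA r r) : tcat x y = tact (tmu x) y.
Proof. exact: (@tcatE 0). Qed.

Lemma tcat_tcons n f (x : tA r n) :
  (r <= n)%N -> tcat (tcons f x) y = tcons f (tcat x y).
Proof.
(* Replacing n by j + r turns [tcat] into [tcat_off]; the next lemmas do the same. *)
move=> /subnK e; move: (n - r)%N e => j e; case: n / e f x => f x.
rewrite (@tcatE j.+1) tcatE.
by rewrite tcat_off_tcons_bilinear //; exact: tcat_off_bilinearP.
Qed.

Lemma tcat_linearl n : (r <= n)%N -> linear (fun x : tA r n => tcat x y).
Proof.
move=> /subnK e; move: (n - r)%N e => j e; case: n / e => a u v.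
by rewrite /= !tcatE; case: (tcat_off_bilinearP j) => lin_j _; exact: lin_j.
Qed.

Lemma tcat_tact n s (x : tA r n) :
  (r <= n)%N -> tcat (tact s x) y = tact s (tcat x y).
Proof.
move=> /subnK e; move: (n - r)%N e => j e; case: n / e s x => s x.
by rewrite !tcatE; case: (tcat_off_bilinearP j) => _; exact.
Qed.

End Concatenation.

(** Used to peel off leftmost factors down to End(m). The predicate is a family because the module
    changes with n. *)
Lemma tA_from_ind m (P : forall n, tA m n -> Prop) :
  (forall n, (m <= n)%N -> linear_closed_set (P n)) ->
  (forall x, P m x) ->
  (forall n f (x : tA m n), (m <= n)%N -> P n x -> P n.+1 (tcons f x)) ->
  forall n x, (m <= n)%N -> P n x.
Proof.
move=> PP Pm PS; elim=> [|n IH] x.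
  by rewrite leqn0 => /eqP m0; subst m.
rewrite leq_eqVlt => /predU1P[e|le_mn]; first by move: x; rewrite -e.
elim/tA_ind: x => //; first by apply: PP; rewrite ltnW.
by move=> f x; apply: PS => //; exact: IH.
Qed.

Lemma tcat_linearr m r n (x : tA r n) :
  (r <= n)%N -> linear (fun y : tA m r => tcat x y).
Proof.
move=> le_rn a u v; move: n x le_rn; apply: tA_from_ind => [n le_rn|x|n f x le_rn IH].
- apply: linear_closed_eq; first exact: tcat_linearl.
  move=> b x x' /=; rewrite !(tcat_linearl _ le_rn) !scalerDr !scalerA.
  by rewrite (mulrC a b) -!addrA; congr (_ + _); rewrite addrCA.
- by rewrite !tcat_diag tA_act_linear.
- by rewrite !tcat_tcons // IH tcons_linearr.
Qed.

Lemma tcatA k m r n (x : tA r n) (y : tA m r) (z : tA k m) :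
  (m <= r)%N -> (r <= n)%N -> tcat (tcat x y) z = tcat x (tcat y z).
Proof.
move=> le_mr le_rn; have le_mn := leq_trans le_mr.
move: n x le_rn; apply: tA_from_ind => [n le_rn|x|n f x le_rn IH].
- apply: linear_closed_eq; last exact: tcat_linearl.
  apply: (linear_fun_comp (tcat_linearl z (le_mn _ le_rn))).
  exact: tcat_linearl.
- by rewrite !tcat_diag tcat_tact.
- by rewrite !tcat_tcons ?le_mn // IH.
Qed.

Lemma tmu_tcat m r n (x : tA r n) (y : tA m r) :
  (r <= n)%N -> tmu (tcat x y) = lcmp (tmu x) (tmu y).
Proof.
move=> le_rn; move: n x le_rn; apply: tA_from_ind => [n le_rn|x|n f x le_rn IH].
- apply: linear_closed_eq.
    by apply: (linear_fun_comp (@tA_mu_linear _ _)); exact: tcat_linearl.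
  apply: (linear_fun_comp _ (@tA_mu_linear _ _)); exact: lcmp_linearl.
- by rewrite tcat_diag (tmu_tact (tA_laws m r)).
- by rewrite tcat_tcons // !tmu_tcons IH lcmpA.
Qed.

(** A unit is given as a lift e of the identity, since [tA n n] does not compute to [lhom n n] for a
    variable n. *)
Lemma tcat1x m n (e : tA n n) (x : tA m n) : tmu e = lid R C n -> tcat e x = x.
Proof. by move=> mue; rewrite tcat_diag mue (tact1 (tA_laws m n)). Qed.

Lemma tcatx1 m n (e : tA m m) (x : tA m n) :
  (m <= n)%N -> tmu e = lid R C m -> tcat x e = x.
Proof.
move=> le_mn mue; move: n x le_mn; apply: tA_from_ind => [n le_mn|x|n f x le_mn IH].
- by apply: linear_closed_eq => //; exact: tcat_linearl.
- apply: tA_mu_inj => //.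
  by rewrite tcat_diag (tmu_tact (tA_laws m m)) mue lcmpf1.
- by rewrite tcat_tcons // IH.
Qed.

(** The cut is at m + 1, as in the factorization condition. Only the images under [tmu] are basis
    morphisms: u may be any lift of a. *)
Definition elementary m n (h : mor C m n) (x : tA m n) :=
  exists a b (u : tA m.+1 n) (v : tA m m.+1),
    [/\ tmu u = of_mor R a, tmu v = of_mor R b, mor_comp a b = h
      & x = tcat u v].

Lemma tmu_elementary m n (h : mor C m n) x :
  (m < n)%N -> elementary h x -> tmu x = of_mor R h.
Proof.
by move=> lt_mn [a [b [u [v [ua vb <- ->]]]]]; rewrite tmu_tcat // ua vb lcmp_basis.
Qed.

(** Elementary tensors span: by induction on n, the leftmost factor f of f (x) x is absorbed into
    the left part u of an elementary x, which leaves the cut at m + 1. *)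
Lemma elementary_ind m n (P : tA m n -> Prop) :
  (m < n)%N -> linear_closed_set P ->
  (forall h x, elementary h x -> P x) -> forall x, P x.
Proof.
elim: n P => // n IH P le_mn PP Pe x; rewrite ltnS in le_mn.
elim/tA_ind: x => // f x; elim/lhom_ind: f => [|f].
  exact: (linear_closed_preim PP (tcons_linearl x)).
move: le_mn; rewrite leq_eqVlt => /predU1P[e|lt_mn].
  (* For n = m there is one factor, in Hom(m,m+1); x is composed into f, and the identity of m + 1
     serves as left part. *)
  case: n / e {IH} P PP Pe x f => P PP Pe x f.
  have [e mue] := tA_mu_surj (lid R C m.+1) (leqnSn _).
  have [x' mux'] := tA_mu_surj (lid R C m) (leqnSn _).
  rewrite -(tcat1x (tcons _ _) mue).
  have ->: tcons (of_mor R f) x = tcons (lcmp (of_mor R f) (tmu x)) x'.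
    by apply: tA_mu_inj => //; rewrite !tmu_tcons mux' lcmpf1.
  elim/lhom_ind: (tmu x) => [|g].
    apply: (linear_closed_preim PP).
    apply: (linear_fun_comp (tcat_linearr e (leqnn _))).
    exact: (linear_fun_comp (tcons_linearl x') (lcmp_linearr _)).
  rewrite lcmp_basis; apply: Pe.
  exists (mor_id C m.+1), (mor_comp f g), e, (tcons (of_mor R (mor_comp f g)) x').
  by rewrite tmu_tcons mux' lcmpf1.
elim/IH: x => //.
  exact: (linear_closed_preim PP (tcons_linearr (of_mor R f))).
move=> h x [a [b [u [v [ua vb _ ->]]]]]; rewrite -tcat_tcons //.
apply: Pe; exists (mor_comp f a), b, (tcons (of_mor R f) u), v.
by rewrite tmu_tcons ua lcmp_basis.
Qed.

End IteratedTensor.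

(** * The relations and the ideal generated in degree d *)

Section Relations.
Local Open Scope ring_scope.
Local Open Scope classical_set_scope.
Variables (R : comPzRingType) (C : natcat) (d : nat).
Notation tA := (tA R C).
Notation tI_gen := (@tI_gen R C d).
Notation tI_summand := (@tI_summand R C d).

Lemma linear_closed_tI m n : linear_closed_set (@tI R C m n).
Proof.
have := @tA_mu_linear R C m n => lmu; split=> [|a x y].
  exact: linear_fun0.
by rewrite /tI /= lmu => -> ->; rewrite scaler0 addr0.
Qed.

Lemma linear_closed_tI_gen m n : linear_closed_set (@tI_gen m n).
Proof.
split=> [|a x y [u us ->] [v vs ->]].
  by exists (fun=> 0); [move=> *; exact: lspan0 | rewrite big1].
exists (fun r => a *: u r + v r) => [r rb|].
  by apply: lspanZD; [exact: us | exact: vs].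
by rewrite big_split scaler_sumr.
Qed.

Lemma tI_summand_gen m n r (t : tA m n) :
  (m <= r <= n - d)%N -> tI_summand r t -> tI_gen t.
Proof.
move=> rb tr; exists (fun s => if s == r then t else 0) => [s _|].
  by case: eqP => [->|_] //; exact: lspan0.
rewrite (bigD1_seq r) ?iota_uniq ?mem_index_iota ?ltnS //= eqxx big1 ?addr0 //.
by move=> s /negPf ->.
Qed.

Lemma tI_gen_tcat m r n (x : tA (r + d) n) (y : tA r (r + d)) (z : tA m r) :
  (m <= r)%N -> (r + d <= n)%N -> tI y -> tI_gen (tcat x (tcat y z)).
Proof.
move=> le_mr le_rn Iy; apply: (@tI_summand_gen _ _ r).
  by rewrite le_mr leq_subRL 1?addnC // (leq_trans (leq_addl r d)).
by apply: sub_lspan; exists x, y, z.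
Qed.

(** The bound m + d <= n guards against truncated subtraction: r <= n - d gives r + d <= n only if d
    <= n. *)
Lemma tI_gen_min m n (P : tA m n -> Prop) : (m + d <= n)%N ->
  linear_closed_set P ->
  (forall r (x : tA (r + d) n) (y : tA r (r + d)) (z : tA m r),
     (m <= r)%N -> (r + d <= n)%N -> tI y -> P (tcat x (tcat y z))) ->
  forall t, tI_gen t -> P t.
Proof.
move=> le_mdn [P0 PZD] Pg t [u us ->]; rewrite big_nat; apply: big_ind => //.
  by move=> x y Px Py; rewrite -[x]scale1r; apply: PZD.
move=> r /andP[le_mr]; rewrite ltnS => le_r.
have := us r; rewrite le_mr le_r => /(_ isT); apply: lspan_min => //.
move=> _ [x [y [z [Iy ->]]]]; apply: Pg => //.
by rewrite addnC -leq_subRL // (leq_trans (leq_addl m d)).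
Qed.

(** Composition is multiplicative on concatenations, so it vanishes as soon as the middle factor is
    a relation. *)
Lemma tI_gen_sub_tI m n : (m + d <= n)%N -> @tI_gen m n `<=` @tI R C m n.
Proof.
move=> le_mdn; apply: tI_gen_min => //; first exact: linear_closed_tI.
move=> r x y z le_mr le_rn Iy; rewrite /tI /= tmu_tcat // tmu_tcat ?leq_addr //.
rewrite Iy (linear_fun0 (lcmp_linearl _)); exact: (linear_fun0 (lcmp_linearr _)).
Qed.

(** By associativity b joins the rightmost factor of each generator. *)
Lemma tI_gen_tcatr m l n (t : tA l n) (b : tA m l) :
  (m <= l)%N -> (l + d <= n)%N -> tI_gen t -> tI_gen (tcat t b).
Proof.
move=> le_ml le_ldn; have le_ln := leq_trans (leq_addr d l) le_ldn.
move: t; apply: tI_gen_min => //.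
  exact: (linear_closed_preim (@linear_closed_tI_gen m n) (tcat_linearl b le_ln)).
move=> r x y z le_lr le_rn Iy.
rewrite tcatA // ?(leq_trans le_lr) ?leq_addr // tcatA ?leq_addr //.
by apply: tI_gen_tcat => //; exact: leq_trans le_lr.
Qed.

(** A relation of degree d is its own generator, with r = m and lifts of identities on both
    sides. *)
Lemma tI_gen_base m (y : tA m (m + d)) : tI y -> tI_gen y.
Proof.
move=> Iy; have [x mux] := tA_mu_surj (lid R C (m + d)) (leqnSn _).
have [z muz] := tA_mu_surj (lid R C m) (leqnSn _).
rewrite -(tcat1x y mux) -[y](tcatx1 _ (leq_addr _ _) muz).
exact: tI_gen_tcat.
Qed.

(** * Consequences of the surjectivity and factorization conditions *)

Section Factorization.
Hypothesis d_ge2 : (2 <= d)%N.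
Hypothesis comp_surj : forall m l n, (m < l)%N -> (l < n)%N ->
  forall h : mor C m n, exists (g : mor C l n) (f : mor C m l), mor_comp g f = h.

Lemma tmu_surj_mor m n (h : mor C m n) :
  (m <= n)%N -> exists x : tA m n, tmu x = of_mor R h.
Proof.
elim: n h => [|n IH] h le_mn; first exact: tA_mu_surj.
(* Surjectivity of composition is assumed only at strictly intermediate objects; for n <= m the
   module is Hom itself. *)
have [le_nm|lt_mn] := leqP n m; first exact: tA_mu_surj.
have [g [f <-]] := comp_surj lt_mn (ltnSn n) h.
have [x mux] := IH f (ltnW lt_mn).
by exists (tcons (of_mor R g) x); rewrite tmu_tcons mux lcmp_basis.
Qed.

Lemma tmu_surj m n (f : lhom R C m n) :
  (m <= n)%N -> exists x : tA m n, tmu x = f.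
Proof.
move=> le_mn; elim/lhom_ind: f => [|h]; last exact: tmu_surj_mor.
split=> [|a f g [x <-] [y <-]].
  by exists 0; rewrite (linear_fun0 (@tA_mu_linear _ _ _ _)).
by exists (a *: x + y); rewrite tA_mu_linear.
Qed.

Lemma elementary_exists m n (h : mor C m n) :
  (m.+1 < n)%N -> exists x : tA m n, elementary h x.
Proof.
move=> lt_mn; have [a [b <-]] := comp_surj (ltnSn m) lt_mn h.
have [u mu_u] := tmu_surj_mor a (ltnW lt_mn).
have [v mu_v] := tmu_surj_mor b (leqnSn _).
by exists (tcat u v), a, b, u, v.
Qed.

(* Choosing an elementary preimage of every basis morphism gives a linear
   section of the composition map, modulo which the kernel is spanned by
   differences of elementary tensors. *)
Lemma tI_sub_elementary m n (P : tA m n -> Prop) :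
  (m.+1 < n)%N -> linear_closed_set P ->
  (forall h x x', elementary h x -> elementary h x' -> P (x - x')) ->
  @tI R C m n `<=` P.
Proof.
move=> lt_mn PP Pe; have lt_mn' := ltnW lt_mn.
have [s sP] := choice (fun h : mor C m n => elementary_exists h lt_mn).
pose sigma : lhom R C m n -> tA m n := linext (s : {classic mor C m n} -> _).
have lsigma : linear sigma by exact: linear_linext.
(* On the kernel this is x itself; stated for all x it is linear in x, hence can be checked on
   elementary tensors. *)
suff key x : P (x - sigma (tmu x)).
  by move=> x Ix; have := key x; rewrite Ix (linear_fun0 lsigma) subr0.
move: x; apply: elementary_ind => //.
  apply: (linear_closed_preim PP) => a x y.
  by rewrite tA_mu_linear lsigma scalerBr opprD addrACA.
move=> h x hx; rewrite (tmu_elementary lt_mn' hx) /sigma linext_basis.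
exact: Pe hx (sP h).
Qed.

Hypothesis factor : forall m n (a1 a2 : mor C m.+1 n) (b1 b2 : mor C m m.+1),
  (m + d < n)%N -> mor_comp a1 b1 = mor_comp a2 b2 ->
  exists (c : mor C (m + d) n) (e1 e2 : mor C m.+1 (m + d)),
    [/\ mor_comp c e1 = a1, mor_comp c e2 = a2 &
        mor_comp e1 b1 = mor_comp e2 b2].

Lemma tI_sub_tI_gen m n : (m + d <= n)%N -> @tI R C m n `<=` @tI_gen m n.
Proof.
(* The induction keeps n fixed and raises m. *)
move=> le_mdn; have [k] := ubnP (n - m).
elim: k m le_mdn => // k IH m le_mdn lt_k.
move: (le_mdn); rewrite leq_eqVlt => /predU1P[<-|lt_mdn].
  exact: tI_gen_base.
(* This is where d >= 2 enters. *)
have lt_m1d : (m.+1 < m + d)%N by rewrite -addn1 ltn_add2l.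
have lt_mn : (m.+1 < n)%N := ltn_trans lt_m1d lt_mdn.
apply: tI_sub_elementary => //; first exact: linear_closed_tI_gen.
move=> _ _ _ [a1 [b1 [u1 [v1 [ua1 vb1 <- ->]]]]]
  [a2 [b2 [u2 [v2 [ua2 vb2 eq_ab ->]]]]].
have [c [e1 [e2 [ce1 ce2 eq_eb]]]] := factor lt_mdn (esym eq_ab).
have [x mux] := tmu_surj_mor c le_mdn.
have [y1 muy1] := tmu_surj_mor e1 (ltnW lt_m1d).
have [y2 muy2] := tmu_surj_mor e2 (ltnW lt_m1d).
(* Two lifts of the same element of Hom(m+1,n) differ by a relation in [tA m.+1 n]; the induction
   hypothesis applies because m + d < n. *)
have replace (u : tA m.+1 n) (y : tA m.+1 (m + d)) (v : tA m m.+1) :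
    tmu u = tmu (tcat x y) -> tI_gen (tcat u v - tcat x (tcat y v)).
  move=> mu_u; rewrite -(tcatA x y v (ltnW lt_m1d) le_mdn).
  rewrite -(linear_funB u (tcat x y) (tcat_linearl v (ltnW lt_mn))).
  apply: tI_gen_tcatr => //; apply: IH => //.
    by rewrite subnS prednK ?subn_gt0 // ltnW.
  by rewrite /tI /= (linear_funB _ _ (@tA_mu_linear _ _ _ _)) mu_u subrr.
have r1 : tI_gen (tcat u1 v1 - tcat x (tcat y1 v1)).
  by apply: replace; rewrite tmu_tcat // mux muy1 lcmp_basis ce1.
have r2 : tI_gen (tcat u2 v2 - tcat x (tcat y2 v2)).
  by apply: replace; rewrite tmu_tcat // mux muy2 lcmp_basis ce2.
(* This is a generator with r = m: its middle factor is a relation since e1 b1 = e2 b2, and its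
   right factor z lifts the identity. *)
have r3 : tI_gen (tcat x (tcat y1 v1) - tcat x (tcat y2 v2)).
  have [z muz] := tA_mu_surj (lid R C m) (leqnSn _).
  rewrite -(linear_funB (tcat y1 v1) (tcat y2 v2) (tcat_linearr x le_mdn)).
  rewrite -(tcatx1 (tcat y1 v1 - tcat y2 v2) (leq_addr _ _) muz).
  apply: tI_gen_tcat => //.
  rewrite /tI /= (linear_funB _ _ (@tA_mu_linear _ _ _ _)).
  rewrite !tmu_tcat ?(ltnW lt_m1d) //.
  by rewrite muy1 muy2 vb1 vb2 !lcmp_basis eq_eb subrr.
have -> : tcat u1 v1 - tcat u2 v2 =
  (tcat u1 v1 - tcat x (tcat y1 v1)) -
  ((tcat u2 v2 - tcat x (tcat y2 v2)) -
   (tcat x (tcat y1 v1) - tcat x (tcat y2 v2))).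
  by rewrite !opprB !addrA !subrK.
do !apply: linear_closedB => //; exact: linear_closed_tI_gen.
Qed.

End Factorization.
End Relations.

Theorem proposition5p2 (R : comPzRingType) (C : natcat) (d : nat) :
  (2 <= d)%N ->
  (forall m l n : nat, (m < l)%N -> (l < n)%N ->
     forall h : mor C m n, exists (g : mor C l n) (f : mor C m l),
       mor_comp g f = h) ->
  (forall (m n : nat) (a1 a2 : mor C m.+1 n) (b1 b2 : mor C m m.+1),
     (m + d < n)%N -> mor_comp a1 b1 = mor_comp a2 b2 ->
     exists (c : mor C (m + d)%N n) (e1 e2 : mor C m.+1 (m + d)%N),
       [/\ mor_comp c e1 = a1, mor_comp c e2 = a2 &
           mor_comp e1 b1 = mor_comp e2 b2]) ->
  relations_gen_le R C d.
Proof.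
move=> d_ge2 comp_surj factor; split=> [m n le_mn f|m n le_mdn].
  by apply: tmu_surj => //; exact: leq_trans (leq_addr 2 m) le_mn.
apply/seteqP; split; first exact: tI_sub_tI_gen.
exact: tI_gen_sub_tI.
Qed.
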